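(* Let $X, Y$ be subspaces of the Cantor set $\mathbf{C}$ and let $f : X \to Y$ be a continuous, one-to-one and open-resolvable function (that is, $f(U)$ is a resolvable subset of $Y$ for every open $U \subset X$). Then $f$ is piecewise open, and hence $f$ is a piecewise homeomorphism.
   Context: $\mathbf{C}$ denotes the Cantor set; subsets of it carry the subspace topology. ''Countable'' means finite or countably infinite. A subset $E$ of a topological space $T$ is resolvable (in $T$) if for each nonempty closed subset $F$ of $T$ we have $\mathrm{cl}_T(F \cap E) \cap \mathrm{cl}_T(F \setminus E) \neq F$. A function is open if it maps open sets to open sets. A function $f : X \to Y$ is open-resolvable if it maps open subsets of $X$ to resolvable subsets of $Y$. A function $f : X \to Y$ with $X \subset \mathbf{C}$ is piecewise open if $X$ admits a countable cover $\mathcal{C}$ by pairwise disjoint closed subsets of $X$ such that for each $C \in \mathcal{C}$ the restriction $f|C$ is open, where $f|C$ is regarded as a function $C \to f(C)$ onto its image (with the subspace topology). A function $f : X \to Y$ with $X \subset \mathbf{C}$ is a piecewise homeomorphism if $X$ admits a countable cover $\mathcal{C}$ by pairwise disjoint closed subsets of $X$ such that for each $C \in \mathcal{C}$ the restriction $f|C : C \to f(C)$ is a homeomorphism. *)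

(* Defs.v *)
From HB Require Import structures.
From mathcomp Require Import all_boot all_order all_algebra.
From mathcomp Require Import all_classical all_reals all_analysis.

Set Implicit Arguments.
Unset Strict Implicit.
Unset Printing Implicit Defensive.

Local Open Scope classical_set_scope.

(* Subspaces are the types [set_type A] (coerced from [A : set T]) with the
   initial topology of the inclusion, not the library's [subspace A]: the
   latter keeps the whole carrier and makes points outside A isolated, so
   global notions (closure, open sets, covers) would be the wrong ones. *)

Definition resolvable {T : topologicalType} (E : set T) : Prop :=
  forall F : set T, closed F -> F !=set0 ->
    closure (F `&` E) `&` closure (F `\` E) <> F.

Definition open_map {S T : topologicalType} (f : S -> T) : Prop :=
  forall U : set S, open U -> open (f @` U).

Definition open_resolvable {S T : topologicalType} (f : S -> T) : Prop :=
  forall U : set S, open U -> resolvable (f @` U).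

Definition homeomorphism {S T : topologicalType} (f : S -> T) : Prop :=
  exists g : T -> S,
    [/\ cancel f g, cancel g f, continuous f & continuous g].

Definition restr_image {S T : Type} (f : S -> T) (C : set S) :
    C -> f @` C :=
  fun x => SigSub (mem_set (imageP f (set_valP x))).

Definition countable_closed_partition {S : topologicalType}
    (CC : set (set S)) : Prop :=
  [/\ countable CC, forall C, CC C -> closed C,
      trivIset CC id & \bigcup_(C in CC) C = [set: S]].

Definition piecewise_open {S T : topologicalType} (f : S -> T) : Prop :=
  exists CC : set (set S), countable_closed_partition CC /\
    forall C, CC C -> open_map (@restr_image S T f C).

Definition piecewise_homeomorphism {S T : topologicalType} (f : S -> T) :
    Prop :=
  exists CC : set (set S), countable_closed_partition CC /\
    forall C, CC C -> homeomorphism (@restr_image S T f C).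

(* Main.v *)
(* Compare on X its own topology with the coarser one pulled back from Y by f.
   It suffices that every nonempty A in X contains a nonempty piece
   A `&` f @^-1` V, V open, on which the inverse of f is continuous: the union
   of all basic f @^-1` V that are covered by countably many closed sets of
   inverse continuity is then X, and a countable closed cover of a
   zero-dimensional second countable space refines to a closed partition.

   Suppose that A has no such piece. Resolvability of f @` W makes the relative
   boundary of f @` W in f @` A nowhere dense for each clopen W, so the points
   q having a clopen neighbourhood W with f q in the closure of the interior of
   f @` (A `\` W) are dense in A for the coarse topology. From such points one
   builds countable sets P and Q, each in the coarse closure of the other, with
   P inside and Q outside an open set U that is an increasing union of clopen
   sets. On the closure of f @` P both f @` U and its complement are dense, so
   f @` U is not resolvable. *)

Require Import Defs.
From mathcomp Require Import all_boot all_order all_algebra.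
From mathcomp Require Import all_classical all_reals all_analysis.

Set Implicit Arguments.
Unset Strict Implicit.
Unset Printing Implicit Defensive.

Local Open Scope classical_set_scope.

(** * Countable clopen bases of the Cantor set and its subspaces *)

Definition separating_clopen_base {T : topologicalType} (B : nat -> set T) :=
  [/\ forall n, clopen (B n),
      forall x y, x <> y -> exists2 n, B n x & ~ B n y &
      forall x U, nbhs x U -> exists2 n, B n x & B n `<=` U].

Definition cylinder (s : seq bool) : set cantor_space :=
  [set x | forall i, (i < size s)%N -> x i = nth false s i].

Lemma clopen_preimage {S T : topologicalType} (g : S -> T) (U : set T) :
  continuous g -> clopen U -> clopen (g @^-1` U).
Proof.
move=> cg [oU cU]; split; first by move/continuousP : cg; apply.
by apply: preimage_closed => // x _; exact: cg.
Qed.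

Lemma coord_clopen (i : nat) (b : bool) :
  clopen [set x : cantor_space | x i = b].
Proof.
apply: (@clopen_preimage _ _ (fun x : cantor_space => x i) [set b]).
  exact: (@proj_continuous nat (fun=> bool) i).
by split; [exact: discrete_open | exact: discrete_closed].
Qed.

Lemma cylinder_clopen s : clopen (cylinder s).
Proof.
have -> : cylinder s =
    \big[setI/setT]_(i < size s) [set x : cantor_space | x i = nth false s i].
  rewrite -(bigcap_mkord (size s)
    (fun i => [set x : cantor_space | x i = nth false s i])).
  apply/seteqP; split => x /= h i; first exact: h.
  by move=> /h.
elim/big_rec : _ => [|i U _ cU]; first exact: clopenT.
by apply: clopenI => //; exact: coord_clopen.
Qed.

Lemma cylinder_mkseq (x : cantor_space) n :
  cylinder (mkseq x n) = [set y | forall i, (i < n)%N -> y i = x i].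
Proof.
rewrite /cylinder size_mkseq; apply/seteqP.
by split => y h i ilt; have := h i ilt; rewrite nth_mkseq.
Qed.

(** The filter of cylinders around [x] converges to [x], because convergence in the product topology
    is tested one coordinate at a time. *)
Lemma nbhs_cylinder (x : cantor_space) U : nbhs x U ->
  exists n, cylinder (mkseq x n) `<=` U.
Proof.
pose F : set_system cantor_space :=
  filter_from setT (fun n => cylinder (mkseq x n)).
have FF : Filter F.
  apply: filter_from_filter => [|m n _ _]; first by exists 0%N.
  exists (maxn m n) => //; rewrite !cylinder_mkseq => y h.
  by split=> i ilt; apply: h; rewrite leq_max ilt ?orbT.
suff : F --> x by move=> Fx /Fx [n _ nU]; exists n.
apply/cvg_sup => i V [_ [[W oW <-] /= Wx WV]].
exists i.+1 => //; rewrite cylinder_mkseq => y /(_ i (ltnSn i)) yx.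
by apply: WV; rewrite /= yx.
Qed.

Lemma cantor_separating_clopen_base :
  exists B : nat -> set cantor_space, separating_clopen_base B.
Proof.
(* A number that decodes to no word is sent to the empty word, whose cylinder is the whole space. *)
pose B n := cylinder (odflt [::] (unpickle n)).
have nB (x : cantor_space) U : nbhs x U -> exists2 n, B n x & B n `<=` U.
  move=> /nbhs_cylinder[n nU]; exists (pickle (mkseq x n));
    rewrite /B pickleK//= => i; rewrite size_mkseq => ilt.
  by rewrite nth_mkseq.
exists B; split => // [n|x y /eqP xy]; first exact: cylinder_clopen.
have /(_ x y xy)[U [oU xU yU]] := hausdorff_accessible cantor_space_hausdorff.
have [n nx nU] : exists2 n, B n x & B n `<=` U.
  by apply: nB; apply: open_nbhs_nbhs; split => //; rewrite in_setE in xU.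
by exists n => // /nU; move: yU; rewrite in_setE.
Qed.

Lemma set_val_continuous {T : topologicalType} (A : set T) :
  continuous (set_val : A -> T).
Proof. exact: initial_continuous. Qed.

Lemma set_type_separating_clopen_base {T : topologicalType} (A : set T)
    (B : nat -> set T) : separating_clopen_base B ->
  separating_clopen_base (fun n => (set_val : A -> T) @^-1` B n).
Proof.
move=> [cB sB bB]; split => [n|x y xy|x U [_ [[W oW <-] /= Wx WU]]].
- by apply: clopen_preimage => //; exact: set_val_continuous.
- by apply: sB => /val_inj.
- have [n nx nW] := bB _ _ (open_nbhs_nbhs (conj oW Wx)).
  by exists n => // y /nW; exact: WU.
Qed.

(** * Inverse continuity and a criterion against resolvability *)

(** For injective [f] this is continuity of the inverse on the image of [C], phrased in [X] and [Y]
    without forming the inverse or subspace types. *)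
Definition inverse_continuous_on {X Y : topologicalType} (f : X -> Y)
    (C : set X) :=
  forall x U, C x -> nbhs x U ->
    exists2 V, nbhs (f x) V & C `&` f @^-1` V `<=` U.

(** Otherwise both images are dense in the closure of the image of [Q0]. One lies in the image of
    [U] and the other, by injectivity, misses it, so this closure refutes resolvability. *)
Lemma open_resolvable_separated {X Y : topologicalType} (f : X -> Y)
    (U Q0 Q1 : set X) :
  injective f -> open_resolvable f -> open U -> Q0 !=set0 ->
  Q0 `<=` U -> Q1 `<=` ~` U ->
  f @` Q0 `<=` closure (f @` Q1) -> ~ (f @` Q1 `<=` closure (f @` Q0)).
Proof.
move=> f_inj f_ores oU [x0 Q0x0] Q0U Q1U Q01 Q10.
have cF : closed (closure (f @` Q0)) by exact: closed_closure.
have clS (B C : set Y) : B `<=` closure C -> closure B `<=` closure C.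
  move=> /closure_subset; have /closure_id <- // := @closed_closure _ C.
have F01 := clS _ _ Q01.
have F0 : closure (f @` Q0) !=set0.
  by exists (f x0); apply: subset_closure; exists x0.
apply: (f_ores U oU _ cF F0); apply/seteqP; split.
  by move=> y [+ _]; apply: clS => z [].
move=> y Fy; split.
  move: y Fy; apply: closure_subset => _ [x Q0x <-]; split.
    by apply: subset_closure; exists x.
  by exists x => //; exact: Q0U.
have := F01 _ Fy; move: y {Fy}; apply: closure_subset => _ [x Q1x <-]; split.
  by apply: Q10; exists x.
by move=> [z Uz /f_inj zx]; apply: (Q1U x) => //; rewrite -zx.
Qed.

(** * Contradiction from a set without pieces of inverse continuity *)

Section dense_inverse_continuity.
Context {X Y : topologicalType} (BX : nat -> set X) (BY : nat -> set Y).
Hypotheses (baseX : separating_clopen_base BX)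
  (baseY : separating_clopen_base BY).
Variable f : X -> Y.
Hypotheses (f_inj : injective f) (f_ores : open_resolvable f).
Variable A : set X.
Hypothesis A0 : A !=set0.

(** For open [V], these are the open subsets of [A] in the topology pulled back from [Y]. *)
Local Notation tr V := (A `&` f @^-1` V).

Hypothesis nowhere_cont : forall V, open V -> tr V !=set0 ->
  ~ inverse_continuous_on f (tr V).

Let baseX_open n : open (BX n).
Proof. by case: baseX => /(_ n)[]. Qed.

Let baseY_open n : open (BY n).
Proof. by case: baseY => /(_ n)[]. Qed.

Lemma clopen_separation (x : X) (s : seq X) : x \notin s ->
  exists W, [/\ clopen W, W x & forall y, y \in s -> ~ W y].
Proof.
case: baseX => cB sB _; elim: s => [_|y s IH].
  by exists setT; split => //; exact: clopenT.
rewrite inE negb_or => /andP[/eqP xy /IH[W [cW Wx Ws]]].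
have [n nx ny] := sB _ _ xy.
exists (W `&` BX n); split => //; first exact: clopenI.
by move=> z; rewrite inE => /predU1P[->|/Ws Wz] [].
Qed.

(** A nonempty trace is never a single point, where the inverse would be trivially continuous. So
    each point of [s] can be left out by passing to a base set around the image of another point. *)
Lemma shrink_avoiding_seq (s : seq X) V : open V -> tr V !=set0 ->
  exists V', [/\ open V', V' `<=` V, tr V' !=set0 &
    forall x, x \in s -> ~ V' (f x)].
Proof.
elim: s => [|x s IH] oV V0; first by exists V; split.
have [V1 [oV1 V1V V10 V1s]] := IH oV V0.
have [y [[Ay V1y] yx]] : exists y, tr V1 y /\ y <> x.
  apply: contrapT => /forallNP h; apply: (nowhere_cont oV1 V10) => z U Vz zU.
  exists setT => [|w [Vw _]]; first exact: filterT.
  have e w' : tr V1 w' -> w' = x.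
    by move=> Vw'; apply: contrapT => wx; apply: (h w').
  by rewrite (e _ Vw) -(e _ Vz); exact: nbhs_singleton.
have [cB sB _] := baseY.
have [n ny nx] : exists2 n, BY n (f y) & ~ BY n (f x).
  by apply: sB => /f_inj.
exists (V1 `&` BY n); split.
- exact: openI.
- by move=> z [/V1V].
- by exists y.
- by move=> z; rewrite inE => /predU1P[->|/V1s Vz] [].
Qed.

(** Otherwise every nonempty trace inside [V] meets both [W] and its complement, and the two parts
    of [tr V] have images in the closure of each other. *)
Lemma open_dichotomy (W : set X) V : open W -> open V -> tr V !=set0 ->
  exists V', [/\ open V', V' `<=` V, tr V' !=set0 &
    tr V' `<=` W \/ tr V' `<=` ~` W].
Proof.
move=> oW oV V0; apply: contrapT => /forallNP h.
have meetW V' : open V' -> V' `<=` V -> tr V' !=set0 ->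
    tr V' `&` W !=set0 /\ tr V' `\` W !=set0.
  move=> oV' V'V V'0; split; apply: contrapT => /forallNP e;
      apply: (h V'); split => //.
    by right => x V'x Wx; exact: (e x).
  by left => x V'x; apply: contrapT => Wx; exact: (e x).
apply: (@open_resolvable_separated _ _ f W (tr V `&` W) (tr V `\` W)) => //.
- by have [] := meetW V oV (fun _ => id) V0.
- move=> _ [x [[Ax Vx] Wx] <-] N; rewrite nbhsE => -[G [oG Gx] GN].
  have [|_ [z [[Az [Gz Vz]] Wz]]] :=
      meetW (G `&` V) (openI oG oV) (@subIsetr _ _ _).
    by exists x.
  by exists (f z); split; [exists z | exact: GN].
- move=> _ [x [[Ax Vx] Wx] <-] N; rewrite nbhsE => -[G [oG Gx] GN].
  have [|[z [[Az [Gz Vz]] Wz]] _] :=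
      meetW (G `&` V) (openI oG oV) (@subIsetr _ _ _).
    by exists x.
  by exists (f z); split; [exists z | exact: GN].
Qed.

(* f q is in the closure of the interior of f @` (A `\` W), both relative to
   f @` A. *)
Definition avoids (W : set X) (q : X) := forall V, open V -> V (f q) ->
  exists V', [/\ open V', V' `<=` V, tr V' !=set0 & tr V' `<=` ~` W].

Lemma avoidsS W W' q : W `<=` W' -> avoids W' q -> avoids W q.
Proof.
move=> WW' h V oV Vq; have [V' [? ? ? sV']] := h V oV Vq.
by exists V'; split => // x /sV' nW /WW'.
Qed.

Lemma not_avoids W q : ~ avoids W q -> exists V, [/\ open V, V (f q) &
  forall V', open V' -> V' `<=` V -> tr V' !=set0 -> ~ (tr V' `<=` ~` W)].
Proof.
move=> /existsNP[V] /not_implyP[oV] /not_implyP[Vq] /forallNP h.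
by exists V; split => // V' ? ? ? ?; apply: (h V').
Qed.

(** Otherwise the inverse is continuous on [tr V]. Near [f x] all nonempty traces meet [BX n]; a
    nearby [y] outside [BX n] would make all nonempty traces near [f y] meet its complement too,
    against [open_dichotomy]. *)
Lemma avoids_dense V : open V -> tr V !=set0 ->
  exists q W, [/\ tr V q, clopen W, W q & avoids W q].
Proof.
move=> oV V0; apply: contrapT => h; apply: (nowhere_cont oV V0) => x U Vx.
have {}h q W : tr V q -> clopen W -> W q -> ~ avoids W q.
  by move=> ? ? ? ?; apply: h; exists q, W.
case: baseX => cB _ bB /bB[n nx nU].
have [V1 [oV1 V1x hV1]] := not_avoids (h x _ Vx (cB n) nx).
exists V1; first exact: open_nbhs_nbhs.
move=> y [Vy V1y]; apply: nU; apply: contrapT => ny.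
have [V2 [oV2 V2y hV2]] := not_avoids (h y _ Vy (clopenC set0 (cB n)) ny).
have V120 : tr (V1 `&` V2) !=set0 by exists y; split => //; exact: Vy.1.
have [V' [oV' V'V V'0]] := open_dichotomy (baseX_open n) (openI oV1 oV2) V120.
case=> [sW|sW]; last by apply: (hV1 V') => // z /V'V[].
by apply: (hV2 V') => // [z /V'V[]|z /sW Bz]//; apply.
Qed.

(* Two exceptions c and c', separated by a clopen set W', would make both W'
   and its complement dense in an open set near f q, against open_dichotomy. *)
Lemma avoids_exception W q : avoids W q -> exists c, forall x, x <> c ->
  exists W', [/\ clopen W', W' x & avoids (W `|` W') q].
Proof.
move=> aW; apply: contrapT => /forallNP h.
have [x xh] : exists x, forall W', clopen W' -> W' x -> ~ avoids (W `|` W') q.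
  (* The point of [A] is only a trial exception that yields a first bad point [x]; trying [x] itself
     then yields the second, [y]. *)
  have [x] := A0; have /existsNP[c] := h x.
  by move=> /not_implyP[_] /forallNP hc; exists c => W' ? ? ?; apply: (hc W').
have /existsNP[y /not_implyP[yx /forallNP yh]] := h x.
have [n ny nx] : exists2 n, BX n y & ~ BX n x by case: baseX => _ + _; apply.
have cB : clopen (BX n) by case: baseX.
have [V1 [oV1 V1q hV1]] : exists V, [/\ open V, V (f q) & forall V', open V' ->
    V' `<=` V -> tr V' !=set0 -> ~ (tr V' `<=` ~` (W `|` BX n))].
  by apply: not_avoids => ?; apply: (yh (BX n)).
have [V2 [oV2 V2q hV2]] := not_avoids (xh _ (clopenC set0 cB) nx).
have [V3 [oV3 V3V V30 V3W]] := aW _ (openI oV1 oV2) (conj V1q V2q).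
have [V4 [oV4 V4V V40 hV4]] := open_dichotomy (baseX_open n) oV3 V30.
have V4W : tr V4 `<=` ~` W by move=> z [Az /V4V Vz]; apply: V3W.
case: hV4 => hV4.
  apply: (hV2 V4) => // [z /V4V/V3V[]//|z V4z [/(V4W z V4z)//|]].
  by apply; exact: hV4.
by apply: (hV1 V4) => // [z /V4V/V3V[]//|z V4z [/(V4W z V4z)//|]]; exact: hV4.
Qed.

Lemma avoids_exceptions W (s : seq X) : (forall q, q \in s -> avoids W q) ->
  exists D : seq X, forall x, x \notin D ->
  exists W', [/\ clopen W', W' x & forall q, q \in s -> avoids (W `|` W') q].
Proof.
elim: s => [|q s IH] aW.
  by exists [::] => x _; exists setT; split => //; exact: clopenT.
have [D hD] : exists D : seq X, forall x, x \notin D -> exists W',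
    [/\ clopen W', W' x & forall q, q \in s -> avoids (W `|` W') q].
  by apply: IH => p ps; apply: aW; rewrite inE ps orbT.
have [c hc] := avoids_exception (aW q (mem_head _ _)).
exists (c :: D) => x; rewrite inE negb_or => /andP[/eqP/hc[W1 [cW1 W1x aW1]]].
move=> /hD[W2 [cW2 W2x aW2]]; exists (W1 `&` W2).
split => //; first exact: clopenI.
move=> p; rewrite inE => /predU1P[->|/aW2].
  by apply: avoidsS aW1; exact: setUS.
by apply: avoidsS; exact: setUS.
Qed.

(** A finite approximation to the sets P and Q and to the open set U. *)
Record stage := Stage { inside : seq X; outside : seq X; nbhd : set X }.

(** The last clause leaves room to continue: near the image of each chosen point, some nonempty
    trace still misses [nbhd s]. *)
Definition admissible (s : stage) := [/\ clopen (nbhd s),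
  forall x, x \in inside s -> nbhd s x,
  forall x, x \in outside s -> ~ nbhd s x &
  forall x, x \in inside s ++ outside s -> avoids (nbhd s) x].

Definition extends (s s' : stage) := [/\ {subset inside s <= inside s'},
  {subset outside s <= outside s'} & nbhd s `<=` nbhd s'].

(** Both new points come from a trace inside [V] that misses [W]: [b] stays outside, and [a] is
    absorbed together with a small clopen set. *)
Lemma extend_stage s V p : admissible s -> open V ->
  p \in inside s ++ outside s -> V (f p) ->
  exists s', [/\ admissible s', extends s s',
    exists2 a, a \in inside s' & V (f a) &
    exists2 b, b \in outside s' & V (f b)].
Proof.
case: s => P Q W [/= cW PW QW aW] oV ps Vp.
have [V1 [oV1 V1V V10 V1W]] := aW p ps V oV Vp.
(* The trace of [V1] misses [W], so near points of [V1] only [W'] has to be avoided. *)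
have aV1 x W' : V1 (f x) -> avoids W' x -> avoids (W `|` W') x.
  move=> V1x aW' O oO Ox.
  have [V' [oV' V'O V'0 V'W]] := aW' _ (openI oO oV1) (conj Ox V1x).
  exists V'; split => // [z /V'O[]//|z V'z [Wz|]]; last exact: V'W.
  by apply: (V1W z) => //; split; [exact: V'z.1|have [] := V'O _ V'z.2].
have [b [Ab V1b]] := V10.
have aWb : avoids W b.
  apply: avoidsS (aV1 b set0 V1b _); first exact: subsetUl.
  by move=> O oO Ob; exists O; split => //; [exists b | move=> z _ []].
have aWs q : q \in b :: P ++ Q -> avoids W q.
  by rewrite inE => /predU1P[->//|/aW].
have [D hD] := avoids_exceptions aWs.
(* The point [a] must differ from the outside points and from the finitely many exceptions in
   [D]. *)
have [V2 [oV2 V2V V20 V2D]] := shrink_avoiding_seq (b :: D ++ Q) oV1 V10.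
have [a [W1 [[Aa V2a] cW1 W1a aW1]]] := avoids_dense oV2 V20.
have [W2 [cW2 W2a aW2]] : exists W', [/\ clopen W', W' a &
    forall q, q \in b :: P ++ Q -> avoids (W `|` W') q].
  apply: hD; apply/negP => aD; apply: (V2D a) => //.
  by rewrite inE mem_cat aD !orbT.
have [W3 [cW3 W3a W3Q]] : exists W', [/\ clopen W', W' a &
    forall y, y \in b :: Q -> ~ W' y].
  apply: clopen_separation; apply/negP => aQ; apply: (V2D a) => //.
  by move: aQ; rewrite !inE mem_cat => /predU1P[->|->]; rewrite ?eqxx ?orbT.
(* [W1] serves avoidance at [a], [W2] preserves it at [b] and the old points, and [W3] keeps [b] and
   [Q] outside. *)
pose W' := W1 `&` W2 `&` W3.
have W'W1 : W' `<=` W1 by move=> z [[]].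
have W'W2 : W' `<=` W2 by move=> z [[]].
exists (Stage (a :: P) (b :: Q) (W `|` W')); split.
- split => /=.
  + by apply: clopenU => //; do 2 apply: clopenI => //.
  + by move=> x; rewrite inE => /predU1P[->|/PW Wx]; [right|left].
  + move=> x xQ [|[_ /(W3Q x xQ)//]]; move: xQ.
    rewrite inE => /predU1P[-> Wb|/QW//]; exact: (V1W b).
  + move=> x; rewrite inE => /predU1P[->|].
      by apply: aV1; [exact: V2V | exact: avoidsS aW1].
    rewrite mem_cat inE orbCA -mem_cat => xs.
    by apply: avoidsS (aW2 x xs); exact: setUS.
- split => /= [x xP|x xQ|]; rewrite ?inE ?xP ?xQ ?orbT//; exact: subsetUl.
- by exists a; [rewrite inE eqxx | exact/V1V/V2V].
- by exists b; [rewrite inE eqxx | exact/V1V].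
Qed.

(** One extension serves every [p] at once, since [a] and [b] only need images in [BY n]. *)
Lemma extend_stage_base s n : admissible s -> exists s',
  [/\ admissible s', extends s s' &
    forall p, p \in inside s ++ outside s -> BY n (f p) ->
    (exists2 a, a \in inside s' & BY n (f a)) /\
    (exists2 b, b \in outside s' & BY n (f b))].
Proof.
move=> ads.
have [[p [ps np]]|h] :=
    pselect (exists p, p \in inside s ++ outside s /\ BY n (f p)).
  have [s' [? ? ? ?]] := extend_stage ads (baseY_open n) ps np.
  by exists s'; split.
by exists s; split => //; [split | move=> p ps np; case: h; exists p].
Qed.

Lemma nowhere_cont_absurd : False.
Proof.
have T0 : tr setT !=set0 by have [x Ax] := A0; exists x.
have [q [W [_ cW Wq aW]]] := avoids_dense openT T0.
have ad0 : admissible (Stage [:: q] [::] W).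
  by split => //= x; rewrite inE => /eqP->.
pose next (n : nat) (s : {s | admissible s}) : {s | admissible s} :=
  let w := cid (extend_stage_base n (svalP s)) in
  exist _ (sval w) (let: And3 ad _ _ := svalP w in ad).
have nextP n s : extends (sval s) (sval (next n s)) /\
    forall p, p \in inside (sval s) ++ outside (sval s) -> BY n (f p) ->
    (exists2 a, a \in inside (sval (next n s)) & BY n (f a)) /\
    (exists2 b, b \in outside (sval (next n s)) & BY n (f b)).
  by rewrite /next; case: (cid _) => s' [].
(* every base index is revisited infinitely often *)
pose task n := logn 2 n.+1.
pose st := fix st n := if n is m.+1 then next (task m) (st m)
  else exist _ (Stage [:: q] [::] W) ad0.
pose P n := inside (sval (st n)); pose Q n := outside (sval (st n)).
pose Wn n := nbhd (sval (st n)).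
have stS n : extends (sval (st n)) (sval (st n.+1)).
  by have [] := nextP (task n) (st n).
have mono m n : (m <= n)%N -> extends (sval (st m)) (sval (st n)).
  move=> /subnK <-; elim: (n - m)%N => [|k [h1 h2 h3]]; first by split.
  have [g1 g2 g3] := stS (k + m)%N; rewrite addSn; split.
  - by move=> x /h1 /g1.
  - by move=> x /h2 /g2.
  - by apply: subset_trans g3.
have step x n k : x \in P n ++ Q n -> BY k (f x) ->
    (exists m, exists2 a, a \in P m & BY k (f a)) /\
    (exists m, exists2 b, b \in Q m & BY k (f b)).
  (* The successor of [m] is an odd multiple of 2^k, so [task m] is [k]; the odd factor 2n+1 forces
     [m] to be at least [n]. *)
  move=> xn kx; pose m := (2 ^ k * (2 * n).+1).-1.
  have mE : m.+1 = (2 ^ k * (2 * n).+1)%N by rewrite prednK// muln_gt0 expn_gt0.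
  have tm : task m = k.
    rewrite /task mE lognM// ?expn_gt0// pfactorK//.
    by rewrite (@logn_coprime 2 _) ?addn0// coprime2n /= mul2n odd_double.
  have nm : (n <= m)%N.
    rewrite -ltnS mE; apply: (@leq_trans (2 * n).+1).
      by rewrite ltnS mul2n -addnn leq_addr.
    by rewrite leq_pmull// expn_gt0.
  have [h1 h2 _] := mono _ _ nm.
  have xm : x \in P m ++ Q m.
    by move: xn; rewrite !mem_cat => /orP[/h1 ->//|/h2 ->]; rewrite orbT.
  have [_ /(_ x xm)] := nextP (task m) (st m).
  by rewrite {1}tm => /(_ kx)[ha hb]; split; exists m.+1; rewrite -tm.
have stad n : admissible (sval (st n)) by exact: svalP.
have baseY_nbhs y N : nbhs y N -> exists2 k, BY k y & BY k `<=` N.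
  by case: baseY => _ _; apply.
apply: (@open_resolvable_separated _ _ f (\bigcup_n Wn n)
  [set x | exists n, x \in P n] [set x | exists n, x \in Q n]) => //.
- by apply: bigcup_open => n _; have [[]] := stad n.
- by exists q; exists 0%N; rewrite /P /= inE.
- by move=> x [n xn]; exists n => //; have [_ + _ _] := stad n; apply.
- move=> x [m xm] [n _ Wx].
  have [_ h _] := mono _ _ (leq_maxl m n).
  have [_ _ g] := mono _ _ (leq_maxr m n).
  by have [_ _ /(_ x (h _ xm)) + _] := stad (maxn m n); apply; exact: g.
- move=> _ [x [n xn] <-] N /baseY_nbhs[k kx kN].
  have [|_ [m [b bm kb]]] := step x n k _ kx; first by rewrite mem_cat xn.
  by exists (f b); split; [exists b => //; exists m | exact: kN].
- move=> _ [x [n xn] <-] N /baseY_nbhs[k kx kN].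
  have [|[m [a am ka]] _] := step x n k _ kx; first by rewrite mem_cat xn orbT.
  by exists (f a); split; [exists a => //; exists m | exact: kN].
Qed.

End dense_inverse_continuity.

(** * Countable closed covers and their refinement to partitions *)

Lemma exists_inverse_continuous_on {X Y : topologicalType} (BX : nat -> set X)
    (BY : nat -> set Y) (f : X -> Y) (A : set X) :
  separating_clopen_base BX -> separating_clopen_base BY ->
  injective f -> open_resolvable f -> A !=set0 ->
  exists V, [/\ open V, A `&` f @^-1` V !=set0 &
    inverse_continuous_on f (A `&` f @^-1` V)].
Proof.
move=> bX bY f_inj f_ores A0; apply: contrapT => /forallNP h.
apply: (nowhere_cont_absurd bX bY f_inj f_ores A0) => V oV V0 cV.
by apply: (h V).
Qed.

Lemma inverse_continuous_onS {X Y : topologicalType} (f : X -> Y)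
    (C D : set X) :
  C `<=` D -> inverse_continuous_on f D -> inverse_continuous_on f C.
Proof.
move=> CD cD x U Cx xU; have [V xV VU] := cD x U (CD _ Cx) xU.
by exists V => // z [/CD Dz Vz]; exact: VU.
Qed.

(** By second countability [G] is itself covered. If it were not all of [X], a piece of inverse
    continuity in its closed complement, cut down to a base set, would make that base set good. *)
Lemma countable_closed_cover {X Y : topologicalType} (BX : nat -> set X)
    (BY : nat -> set Y) (f : X -> Y) :
  separating_clopen_base BX -> separating_clopen_base BY ->
  continuous f -> injective f -> open_resolvable f ->
  exists C : nat -> set X, [/\ forall n, closed (C n),
    forall n, inverse_continuous_on f (C n) & \bigcup_n C n = [set: X]].
Proof.
move=> bX bY f_cont f_inj f_ores.
pose covered G := exists CC : set (set X), [/\ countable CC,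
  forall C, CC C -> closed C /\ inverse_continuous_on f C &
  G `<=` \bigcup_(C in CC) C].
pose good n := covered (f @^-1` BY n).
pose G := \bigcup_(n in good) f @^-1` BY n.
have [cBY _ nBY] := bY.
have clopen_pre n : clopen (f @^-1` BY n) by apply: clopen_preimage.
have [CC [countCC CCP GCC]] : covered G.
  have /choice[F FP] n : exists CC : set (set X), [/\ countable CC,
      forall C, CC C -> closed C /\ inverse_continuous_on f C &
      good n -> f @^-1` BY n `<=` \bigcup_(C in CC) C].
    have [[CC [? ? ?]]|ng] := pselect (good n); first by exists CC.
    by exists set0; split.
  exists (\bigcup_n F n); split.
  - by apply: bigcup_countable => // n _; have [] := FP n.
  - by move=> C [n _ FC]; have [_ + _] := FP n; apply.
  - move=> x [n gn xn]; have [_ _ /(_ gn x xn)[C FC Cx]] := FP n.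
    by exists C => //; exists n.
have GT x : G x.
  apply: contrapT => Gx.
  have [V [oV [y [Gy Vy]] cV]] := exists_inverse_continuous_on bX bY f_inj
    f_ores (ex_intro (~` G) x Gx).
  have [n ny nV] := nBY _ _ (open_nbhs_nbhs (conj oV Vy)).
  apply: Gy; exists n => //; exists (CC `|` [set ~` G `&` f @^-1` BY n]); split.
  - by rewrite -bigcup2E; apply: bigcup_countable => // -[|[|k]] _ //=.
  - move=> C [/CCP//|->]; split; last first.
      by apply: inverse_continuous_onS cV => z [Gz /nV].
    apply: closedI; last by have [] := clopen_pre n.
    by apply: open_closedC; apply: bigcup_open => k _; have [] := clopen_pre k.
  - move=> z nz; have [/GCC[C CCC Cz]|Gz] := pselect (G z).
      by exists C => //; left.
    by exists (~` G `&` f @^-1` BY n) => //; right.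
have /countable_injP[g g_inj] := countCC.
(* Indices that code no member of [CC] give the empty set, which is harmless. *)
pose C n := \bigcup_(D in [set D | CC D /\ g D = n]) D.
have CE n : C n = set0 \/ CC (C n).
  have [[D [CD gD]]|h] := pselect (exists D, CC D /\ g D = n).
    right; suff -> : C n = D by [].
    apply/seteqP; split => [x [E [CE gE] Ex]|x Dx]; last by exists D.
    by suff <- : E = D by []; apply: g_inj; rewrite ?inE// gD.
  by left; apply/seteqP; split => // x [D DP _]; apply: h; exists D.
exists C; split => [n|n|].
- by have [->|/CCP[]//] := CE n; exact: closed0.
- by have [->|/CCP[]//] := CE n.
- apply/seteqP; split => // x _; have [D CD Dx] := GCC _ (GT x).
  by exists (g D) => //; exists D.
Qed.

(** The part of [C n] outside the earlier sets need not be closed, but it is open in [C n]. It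
    splits into relatively clopen pieces according to the first base set that contains the point and
    misses all earlier sets. *)
Lemma closed_partition_refinement {X : topologicalType} (B C : nat -> set X) :
  separating_clopen_base B -> (forall n, closed (C n)) ->
  \bigcup_n C n = [set: X] ->
  exists CC, countable_closed_partition CC /\
    forall D, CC D -> exists n, D `<=` C n.
Proof.
move=> [cB _ nB] cC CT.
pose clear n i := forall m, (m < n)%N -> B i `&` C m = set0.
pose D (p : nat * nat) := [set x | [/\ C p.1 x, B p.2 x, clear p.1 p.2 &
  forall j, (j < p.2)%N -> clear p.1 j -> ~ B j x]].
have first_index (P : nat -> Prop) : (exists n, P n) ->
    exists2 n, P n & forall m, (m < n)%N -> ~ P m.
  move=> [k Pk]; have exP : exists n, `[< P n >] by exists k; apply/asboolP.
  case: (ex_minnP exP) => n /asboolP Pn nP; exists n => // m mn /asboolP/nP.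
  by rewrite leqNgt mn.
have D_inj p q x : D p x -> D q x -> p = q.
  have D1 (p' q' : nat * nat) : D p' x -> D q' x -> ~ (p'.1 < q'.1)%N.
    move=> [Cx _ _ _] [_ Bx cl _] /cl /seteqP[/(_ x) + _]; exact.
  move: p q => [n i] [n' i'] Dp Dq.
  have nn' : n = n'.
    case: (ltngtP n n') => // lt; exfalso; first exact: (D1 _ _ Dp Dq).
    exact: (D1 _ _ Dq Dp).
  subst n'; congr pair; case: Dp Dq => _ Bi cli hi [_ Bi' cli' hi'].
  by case: (ltngtP i i') => // lt; exfalso; [apply: (hi' i)|apply: (hi i')].
exists (range D); split; last by move=> _ [p _ <-]; exists p.1 => x [].
split.
- exact: (sub_countable (card_image_le _ _)).
- move=> _ [[n i] _ <-]; have [cl|ncl] := pselect (clear n i); last first.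
    have -> : D (n, i) = set0 by apply/seteqP; split => // x [].
    exact: closed0.
  have -> : D (n, i) = C n `&` B i `&`
      \bigcap_(j in [set j | (j < i)%N /\ clear n j]) ~` B j.
    apply/seteqP; split => [x [Cx Bx _ h]|x [[Cx Bx] h]].
      by split => // j [ji /(h j ji)].
    by split => // j ji clj; apply: h.
  apply: closedI; first by apply: closedI => //; have [] := cB i.
  by apply: closed_bigI => j _; apply: open_closedC; have [] := cB j.
- move=> _ _ [p _ <-] [q _ <-] [x [px qx]].
  by rewrite (D_inj _ _ _ px qx).
- apply/seteqP; split => // x _.
  have [n Cx nmin] : exists2 n, C n x & forall m, (m < n)%N -> ~ C m x.
    apply: first_index.
    by have [n _ Cx] : (\bigcup_n C n) x; [rewrite CT | exists n].
  have [i [cl Bx] imin] : exists2 i, clear n i /\ B i x &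
      forall j, (j < i)%N -> ~ (clear n j /\ B j x).
    apply: first_index.
    have oO : open (~` \bigcup_(m < n) C m).
      by rewrite openC; apply: closed_bigcup => // m _; exact: cC.
    have [|i Bx iO] := nB x (~` \bigcup_(m < n) C m).
      by apply: open_nbhs_nbhs; split => // -[m /= /nmin].
    exists i; split => // m mn; apply/seteqP; split => // z [Bz Cz].
    by apply: (iO z Bz); exists m.
  exists (D (n, i)); first by exists (n, i).
  by split => // j ji clj Bj; apply: (imin j).
Qed.

(** * From inverse continuity to homeomorphic pieces *)

Lemma restr_image_homeomorphism {X Y : topologicalType} (f : X -> Y)
    (C : set X) : continuous f -> injective f -> inverse_continuous_on f C ->
  homeomorphism (@restr_image X Y f C).
Proof.
move=> f_cont f_inj cC.
pose g (y : f @` C) : C := let w := cid2 (set_valP y) in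
  SigSub (mem_set (s2valP w)).
have fg y : f (set_val (g y)) = set_val y.
  by rewrite /g; case: (cid2 _).
exists g; split.
- by move=> x; apply/val_inj/f_inj; exact: fg.
- by move=> y; apply/val_inj; exact: fg.
- apply/continuousP => _ [W oW <-]; exists (f @^-1` W) => //.
  by move/continuousP : f_cont; apply.
- move=> y U [_ [[W oW <-] /= Wg WU]].
  have [V yV VW] := cC _ _ (set_valP (g y)) (open_nbhs_nbhs (conj oW Wg)).
  have : nbhs y (set_val @^-1` V) by apply: set_val_continuous; rewrite -fg.
  apply: filterS => z Vz; apply: WU; apply: VW; split; first exact: set_valP.
  by rewrite /= fg.
Qed.

Lemma homeomorphism_open_map {S T : topologicalType} (h : S -> T) :
  homeomorphism h -> open_map h.
Proof.
move=> [g [hK gK _ /continuousP cg]] U oU.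
suff -> : h @` U = g @^-1` U by exact: cg.
apply/seteqP; split => [_ [x Ux <-]|y Uy]; first by rewrite /= hK.
by exists (g y).
Qed.

Theorem theorem1 (X Y : set cantor_space) (f : X -> Y)
    (f_cont : continuous f) (f_inj : injective f)
    (f_ores : open_resolvable f) :
  piecewise_open f /\ piecewise_homeomorphism f.
Proof.
have [B bB] := cantor_separating_clopen_base.
have bX := set_type_separating_clopen_base X bB.
have bY := set_type_separating_clopen_base Y bB.
have [C [cC iC CT]] := countable_closed_cover bX bY f_cont f_inj f_ores.
have [CC [partCC CCC]] := closed_partition_refinement bX cC CT.
have homeo D : CC D -> homeomorphism (@restr_image X Y f D).
  move=> /CCC[n DC]; apply: restr_image_homeomorphism => //.
  exact: inverse_continuous_onS (iC n).
(* One partition serves both claims; openness on the pieces is read off from the homeomorphisms. *)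
by split; exists CC; split => // D /homeo // /homeomorphism_open_map.
Qed.
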